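(* Let $\Lambda$ be the set of functions $\Psi$ of the form \[ \Psi(s)=bs-\int_0^\infty(1-e^{-sx})\,\mathrm dh(x),\qquad s\ge0, \] where $b\ge0$ and $h$ is a decreasing log-convex function on $(0,+\infty)$ satisfying $\int_0^1h(x)\,\mathrm dx<\infty$, $\int_0^\infty h(x)\,\mathrm dx=+\infty$ and $\lim_{x\to\infty}h(x)=0$. Then $\Lambda\subset\Sigma$.
   Context: A Bernstein function is a function $\Phi(s)=as+\int_{(0,\infty)}(1-e^{-sx})\lambda(\mathrm dx)$, $s\ge0$, with $a\ge0$ and $\lambda$ a measure on $(0,\infty)$ with $\int(x\wedge1)\lambda(\mathrm dx)<\infty$. For $\Phi\not\equiv0$, $\Phi^\ast(s)=s/\Phi(s)$ for $s>0$, $\Phi^\ast(0)=\lim_{s\to0}\Phi^\ast(s)$; $\Sigma$ is the set of Bernstein functions $\Phi\not\equiv0$ such that $\Phi^\ast$ is a Bernstein function. *)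

(* Defs.v *)
From HB Require Import structures.
From mathcomp Require Import all_boot all_order all_algebra.
From mathcomp Require Import all_classical all_reals all_analysis.
Set Implicit Arguments. Unset Strict Implicit. Unset Printing Implicit Defensive.
Import Order.TTheory GRing.Theory Num.Theory.
Import numFieldNormedType.Exports.
Local Open Scope classical_set_scope.
Local Open Scope ring_scope.

(* Bernstein function on [0,oo): Phi(s) = a s + int_(0,oo) (1 - e^{-sx}) lambda(dx),
   a >= 0, lambda a (Borel) measure with int_(0,oo) (x /\ 1) lambda(dx) < oo.
   Only the restriction of lambda to (0,oo) matters. *)
Definition bernstein (R : realType) (Phi : R -> R) : Prop :=
  exists (a : R) (lam : {measure set (measurableTypeR R) -> \bar R}),
    0 <= a /\
    (\int[lam]_(x in `]0%R, +oo[) (Num.min x 1)%:E < +oo)%E /\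
    forall s : R, 0 <= s ->
      Phi s = a * s + fine (\int[lam]_(x in `]0%R, +oo[) (1 - expR (- (s * x)))%:E).

Definition conj_bernstein (R : realType) (Phi Phistar : R -> R) : Prop :=
  (forall s : R, 0 < s -> Phistar s = s / Phi s) /\
  ((fun s => s / Phi s) @ at_right 0 --> Phistar 0).

Definition Sigma (R : realType) (Phi : R -> R) : Prop :=
  bernstein Phi /\ (exists s : R, 0 <= s /\ Phi s != 0) /\
  exists Phistar : R -> R, conj_bernstein Phi Phistar /\ bernstein Phistar.

Definition log_convex_pos (R : realType) (h : R -> R) : Prop :=
  (forall x : R, 0 < x -> 0 < h x) /\
  forall (x y t : R), 0 < x -> 0 < y -> 0 <= t -> t <= 1 ->
    ln (h ((1 - t) * x + t * y)) <= (1 - t) * ln (h x) + t * ln (h y).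

Definition decreasing_pos (R : realType) (h : R -> R) : Prop :=
  forall x y : R, 0 < x -> x <= y -> h y <= h x.

Definition minus_dh (R : realType) (h : R -> R)
    (mu : {measure set (measurableTypeR R) -> \bar R}) : Prop :=
  forall a b : R, 0 < a -> a <= b -> mu `]a, b]%classic = (h a - h b)%:E.

(* Lambda: Psi(s) = b s - int_0^oo (1 - e^{-sx}) dh(x), i.e.
   Psi(s) = b s + int_(0,oo) (1 - e^{-sx}) mu(dx) with mu = -dh. *)
Definition Lambda (R : realType) (Psi : R -> R) : Prop :=
  exists (b : R) (h : R -> R) (mu : {measure set (measurableTypeR R) -> \bar R}),
    0 <= b /\ decreasing_pos h /\ log_convex_pos h /\
    (\int[lebesgue_measure]_(x in `]0%R, 1%R]) (h x)%:E < +oo)%E /\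
    (\int[lebesgue_measure]_(x in `]0%R, +oo[) (h x)%:E = +oo)%E /\
    (h x @[x --> +oo] --> 0) /\
    minus_dh h mu /\
    forall s : R, 0 <= s ->
      Psi s = b * s + fine (\int[mu]_(x in `]0%R, +oo[) (1 - expR (- (s * x)))%:E).

(* Main.v *)
(** Let [l] be the Laplace transform of [h]. By Tonelli [Psi s = s * (b + l s)], so that
    [s / Psi s = 1 / (b + l s)], and one needs a decreasing [H >= 0] and [a >= 0] with
    [s * (a + laplace H s) = 1 / (b + l s)], that is, a "tail" [H] solving a renewal equation for [h].
    On a grid of mesh [d] this is Kaluza's theorem: log-convexity of [h] makes the discrete renewal
    equation solvable with decreasing nonnegative [K]. The corresponding step functions have Laplace
    transforms converging, as [d] tends to 0, to [1 / (s * (b + l s))]; Helly's selection theorem gives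
    [H], and [a] is the mass that escapes to the origin. Finally [H] is the tail of the image of
    Lebesgue measure under the generalized inverse of [H], which is the Levy measure of [s / Psi s]. *)
Require Import Defs.
From HB Require Import structures.
From mathcomp Require Import all_boot all_order all_algebra.
From mathcomp Require Import all_classical all_reals all_analysis.
From mathcomp Require Import measurable_realfun ring lra.

Set Implicit Arguments.
Unset Strict Implicit.
Unset Printing Implicit Defensive.
Import Order.TTheory GRing.Theory Num.Theory.
Import numFieldNormedType.Exports.
Local Open Scope classical_set_scope.
Local Open Scope ring_scope.

(** * Kaluza's theorem for log-convex sequences *)

Lemma course_of_values_exists (T : Type) (x0 : T) (F : nat -> seq T -> T) :
  exists f : nat -> T, forall n, f n = F n (mkseq f n).
Proof.
pose fix fs n := if n is m.+1 then rcons (fs m) (F m (fs m)) else [::].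
have sfs n : size (fs n) = n by elim: n => //= n ih; rewrite size_rcons ih.
pose f n := nth x0 (fs n.+1) n.
have fE n : f n = F n (fs n) by rewrite /f /= nth_rcons sfs ltnn eqxx.
exists f => n; rewrite fE; congr F.
elim: n => // n ih; rewrite mkseqS -ih /=; congr rcons.
by rewrite fE.
Qed.

(** The ratios [u n.+1 / u n] increase with [n]; the inequality compares two of them after
    cross-multiplication, by induction on the gap [n - i]. *)
Lemma log_convex_seq_ratio (R : realFieldType) (u : nat -> R) :
  (forall n, 0 < u n) -> (forall n, u n.+1 ^+ 2 <= u n * u n.+2) ->
  forall i n, (i <= n)%N -> u i.+1 * u n <= u i * u n.+1.
Proof.
move=> u0 ulc i n /subnK <-; elim: (n - i)%N => [|k ih]; first by rewrite mulrC.
rewrite addSn -(ler_pM2r (u0 (k + i)%N)).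
apply: (@le_trans _ _ (u i * u (k + i).+1 ^+ 2)).
  by have := ler_wpM2r (ltW (u0 (k + i).+1)) ih; nra.
by have := ler_wpM2l (ltW (u0 i)) (ulc (k + i)%N); nra.
Qed.

(* Kaluza: a decreasing log-convex sequence is (up to scaling) a renewal sequence, and [H] is the
   sequence of tails of the associated defective step distribution. *)
Lemma kaluza (R : realFieldType) (u : nat -> R) :
  (forall n, 0 < u n) -> (forall n, u n.+1 ^+ 2 <= u n * u n.+2) ->
  {homo u : m n / (m <= n)%N >-> n <= m} ->
  exists H : nat -> R, [/\ forall n, 0 <= H n,
    {homo H : m n / (m <= n)%N >-> n <= m} &
    forall n, \sum_(i < n.+1) u i * H (n - i)%N = 1].
Proof.
move=> u0 ulc und.
(* The renewal equation [renewal] is solved for its last unknown [f n]. The step distribution is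
   shifted by one: [f n] is the mass at [n + 1]. The index [n - i.+1] stays below [n], so the
   default of [nth] is never read. *)
have [f fE] := course_of_values_exists 0 (fun n s =>
  (u n.+1 - \sum_(i < n) u i.+1 * nth 0 s (n - i.+1)) / u 0%N).
have renewal n : \sum_(i < n.+1) u i * f (n - i)%N = u n.+1.
  rewrite big_ord_recl subn0 [f n]fE mulrC divfK ?gt_eqF//.
  rewrite -addrA -[RHS]addr0; congr (_ + _).
  apply/eqP; rewrite addrC subr_eq0; apply/eqP/eq_bigr => i _.
  by rewrite nth_mkseq// ltn_subrL/=; case: n i => // -[].
have f0 n : 0 <= f n.
  elim/ltn_ind: n => -[_|m ih].
    by rewrite fE big_ord0 subr0 divr_ge0// ltW.
  rewrite fE divr_ge0//; last exact: ltW.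
  (* After multiplication by [u m.+1], expanding the factor [u m.+1] of [u m.+2] by the renewal
     equation turns both products into sums over the same [f (m - i)], compared term by term through
     log-convexity. *)
  rewrite -(pmulr_rge0 _ (u0 m.+1)) mulrBr -{1}renewal mulr_suml mulr_sumr.
  rewrite subr_ge0; apply: ler_sum => i _.
  have im : (i <= m)%N by rewrite -ltnS.
  rewrite nth_mkseq ?ltn_subrL// subSS.
  rewrite mulrA [leRHS]mulrAC ler_wpM2r//; first by rewrite ih// ltnS leq_subr.
  by rewrite mulrC; apply: log_convex_seq_ratio => //; exact: leqW.
have fsum n : \sum_(i < n) f i <= 1.
  case: n => [|m]; first by rewrite big_ord0.
  (* Since [u] decreases, replacing each weight [u i] by [u m.+1] in the renewal equation can only
     lower the sum. *)
  rewrite -(ler_pM2l (u0 m.+1)) mulr1 -{2}renewal.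
  rewrite (reindex_inj rev_ord_inj) mulr_sumr; apply: ler_sum => i _.
  by rewrite /= subSS ler_wpM2r// und// ltnW.
exists (fun n => (1 - \sum_(i < n) f i) / u 0%N); split => [n|m n mn|n].
- by rewrite divr_ge0 ?subr_ge0// ltW.
- rewrite ler_pM2r ?invr_gt0// lerD2l lerN2 -(subnKC mn) big_split_ord/= lerDl.
  by apply: sumr_ge0 => i _.
- elim: n => [|n ih].
    by rewrite big_ord1 big_ord0 subr0 mul1r divff// gt_eqF.
  (* From [n] to [n.+1] the old terms lose [u i * f (n - i) / u 0], in total [u n.+1 / u 0] by the
     renewal equation, which is exactly the new term [u n.+1 * H 0]. *)
  rewrite big_ord_recr/= subnn big_ord0 subr0.
  rewrite -[RHS]ih -(renewal n) mul1r mulr_suml -big_split/=.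
  apply: eq_bigr => i _; have im : (i <= n)%N by rewrite -ltnS.
  rewrite subSn// big_ord_recr/=; field; exact: lt0r_neq0.
Qed.

(** * Series with nonnegative terms *)

Local Open Scope ereal_scope.

(** Tonelli for double series: [c i n] shifts row [i] to the right by [i] places, padding with
    zeros, so that column sums become convolutions. The series of [b] may diverge, which lets its
    finiteness be deduced from the identity. *)
Lemma nneseries_cauchy_product (R : realType) (a b : nat -> R) (A : R) :
  (forall n, 0 <= a n)%R -> (forall n, 0 <= b n)%R ->
  \sum_(i <oo) (a i)%:E = A%:E ->
  A%:E * \sum_(j <oo) (b j)%:E =
  \sum_(n <oo) (\sum_(i < n.+1) a i * b (n - i)%N)%R%:E.
Proof.
move=> a0 b0 AE.
have c0 i j : 0 <= (a i * b j)%:E by rewrite lee_fin mulr_ge0.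
pose c i n := if (i <= n)%N then (a i * b (n - i)%N)%:E else 0.
have c_ge0 i n : 0 <= c i n by rewrite /c; case: ifP.
rewrite -nneseriesZl; last by move=> i _; rewrite lee_fin.
transitivity (\sum_(j <oo) \sum_(i <oo) (a i * b j)%:E).
  apply: eq_eseriesr => j _; rewrite -AE muleC -nneseriesZl; last first.
    by move=> i _; rewrite lee_fin.
  by apply: eq_eseriesr => i _; rewrite -EFinM mulrC.
rewrite nneseries_interchange//.
transitivity (\sum_(i <oo) \sum_(n <oo) c i n).
  apply: eq_eseriesr => i _.
  rewrite (@nneseries_split _ (c i) 0 i)// add0n.
  rewrite big_nat_cond big1 ?add0e; last first.
    by move=> k /andP[/andP[_ ki] _]; rewrite /c leqNgt ki.
  rewrite -(@nneseries_addn _ (c i) i)//; apply: eq_eseriesr => j _.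
  by rewrite /c leq_addl addnK.
rewrite nneseries_interchange//; apply: eq_eseriesr => n _.
rewrite (@nneseries_split _ _ 0 n.+1)// add0n eseries0 ?adde0; last first.
  by move=> k nk _; rewrite /c leqNgt nk.
rewrite big_mkord -sumEFin; apply: eq_bigr => i _.
by rewrite /c -ltnS ltn_ord.
Qed.

Lemma nneseries_geometric (R : realType) (z : R) : (0 <= z < 1)%R ->
  \sum_(n <oo) (z ^+ n)%:E = ((1 - z)^-1)%:E.
Proof.
move=> /andP[z0 z1]; apply/cvg_lim => //.
under eq_fun do rewrite sumEFin.
apply: cvg_EFin; first exact: nearW.
rewrite (_ : fine \o _ = series (geometric 1%R z)); last first.
  by apply/funext => n; rewrite /series /=; apply: eq_bigr => i _; rewrite mul1r.
by rewrite -[X in _ --> X]mul1r; apply: cvg_geometric_series; rewrite ger0_norm.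
Qed.

Local Close Scope ereal_scope.

(** * Laplace exponents expressed through tails of measures *)

Lemma decreasing_pos_measurable (R : realType) (h : R -> R) :
  decreasing_pos h -> measurable_fun (`]0, +oo[ : set R) h.
Proof.
move=> hnd; apply: (measurability (@RGenCInfty.G R)) => [|/= _ [_] [r] -> <-].
  exact: RGenCInfty.measurableE.
apply: is_interval_measurable => s t/=; rewrite !in_itv/= !andbT.
move=> [s0 _] [t0 rt] u /andP[su ut]; have u0 := lt_le_trans s0 su.
by rewrite !in_itv/= !andbT; split => //; rewrite (le_trans rt)// hnd.
Qed.

Section tail_integral.
Context {R : realType}.
Local Open Scope ereal_scope.
Notation leb := (@lebesgue_measure R).
Variables (m : {measure set (measurableTypeR R) -> \bar R}) (H : R -> R).
Hypothesis tail : forall t, (0 < t)%R -> m `]t, +oo[%classic = (H t)%:E.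

Let D : set (measurableTypeR R) := `]0%R, +oo[.
Let mD : measurable D. Proof. exact: measurable_itv. Qed.

(** Needed for Tonelli: the restricted measure ignores the complement of [D], and each []1/(n+1),
    +oo[] has the finite mass given by [H]. *)
Lemma tail_sigma_finite : sigma_finite setT (mrestr m mD).
Proof.
exists (fun n => ~` D `|` `](n.+1%:R^-1)%R, +oo[%classic).
  apply/esym; rewrite -subTset => x _; have [x0|x0] := ltP 0%R x; last first.
    by exists 0%N => //; left; rewrite /D /= in_itv/= andbT; apply/negP; rewrite -leNgt.
  exists (Num.truncn x^-1%R) => //; right.
  by rewrite /= in_itv/= andbT invf_plt ?posrE// truncnS_gt.
move=> n; split.
  by apply: measurableU; [exact: measurableC|exact: measurable_itv].
rewrite /mrestr setIUl setICl set0U setIidl; last first.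
  by move=> x; rewrite /D /= !in_itv/= !andbT; apply: lt_trans; rewrite invr_gt0.
by rewrite tail ?ltry// invr_gt0.
Qed.

Let mr : {sigma_finite_measure set (measurableTypeR R) -> \bar R} :=
  HB.pack (mrestr m mD) (Measure_isSigmaFinite.Build _ _ _ _ tail_sigma_finite).

(** Layer-cake formula: Tonelli over the region [0 < t < x], whose section at fixed [t] has
    [m]-measure [H t]. *)
Lemma integral_tail (k : R -> R) : measurable_fun setT k -> (forall t, 0 <= k t)%R ->
  \int[m]_(x in `]0%R, +oo[) \int[leb]_(t in `]0%R, x[) (k t)%:E =
  \int[leb]_(t in `]0%R, +oo[) (k t * H t)%:E.
Proof.
move=> mk k0.
pose A : set (measurableTypeR R * measurableTypeR R) :=
  [set z | 0 < z.2 /\ z.2 < z.1]%R.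
have mA : measurable A.
  have -> : A = snd @^-1` `]0%R, +oo[ `&`
      (fun z : measurableTypeR R * measurableTypeR R => z.1 - z.2)%R @^-1` `]0%R, +oo[.
    by apply/seteqP; split => -[x t]; rewrite /A /= !in_itv/= !andbT subr_gt0.
  apply: measurableI.
    rewrite -[X in measurable X]setTI.
    by apply: measurable_snd => //; exact: measurable_itv.
  rewrite -[X in measurable X]setTI.
  by apply: measurable_funB => //; exact: measurable_itv.
pose F := (fun z : measurableTypeR R * measurableTypeR R => (k z.2)%:E) \_ A.
have mF : measurable_fun setT F.
  apply/(measurable_restrictT _ _).1 => //; apply: measurable_funTS.
  by apply/measurable_EFinP; exact: (measurableT_comp mk measurable_snd).
have F0 z : 0 <= F z by rewrite /F patchE; case: ifP => // _; rewrite lee_fin.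
transitivity (\int[mr]_x \int[leb]_t F (x, t)).
  transitivity (\int[mr]_(x in D) \int[leb]_(t in `]0%R, x[) (k t)%:E).
    by apply: eq_measure_integral => B mB BD; rewrite /= /mrestr setIidl.
  rewrite integral_mkcond; apply: eq_integral => x _.
  rewrite patchE; case: ifPn => [xD|xD].
    rewrite integral_mkcond; apply: eq_integral => t _.
    rewrite /F !patchE; congr (if _ then _ else _).
    by apply/idP/idP; rewrite !inE /A /= in_itv/= => /andP.
  rewrite integral0_eq// => t _; rewrite /F patchE ifF//; apply/negbTE.
  apply: contra xD; rewrite !inE /A /D /= in_itv/= andbT => -[t0]; exact: lt_trans.
rewrite (@fubini_tonelli _ _ _ _ _ mr leb F)// [RHS]integral_mkcond.
apply: eq_integral => t _; rewrite patchE; case: ifPn => tD.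
  move: (tD); rewrite inE /= in_itv/= andbT => t0.
  transitivity (\int[mr]_(x in `]t, +oo[) (k t)%:E).
    rewrite [RHS]integral_mkcond; apply: eq_integral => x _.
    rewrite /F !patchE; congr (if _ then _ else _).
    by apply/idP/idP; rewrite !inE /A /= in_itv/= andbT => // -[].
  rewrite integral_cst//.
  rewrite /= /mrestr setIidl ?tail//.
  by move=> x; rewrite /D /= !in_itv/= !andbT; apply: lt_trans.
apply: integral0_eq => x _; rewrite /F patchE ifF//; apply/negbTE.
by apply: contra tD; rewrite !inE /A /= in_itv/= andbT => -[].
Qed.

End tail_integral.

Section exp_integral.
Context {R : realType}.
Local Open Scope ereal_scope.
Notation leb := (@lebesgue_measure R).
Variable s : R.
Hypothesis s0 : (0 < s)%R.

Lemma continuous_expRM : continuous (fun t : R => expR (- (s * t))).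
Proof.
move=> t; apply: continuous_comp; last exact: continuous_expR.
by apply: cvgN; apply: cvgM; [exact: cvg_cst|exact: cvg_id].
Qed.

Lemma measurable_expRM (A : set R) : measurable_fun A (fun t : R => expR (- (s * t))).
Proof.
by apply: measurable_funTS; apply: continuous_measurable_fun; exact: continuous_expRM.
Qed.

Let dE (t : R) :
  is_derive t 1%R (fun t => - expR (- (s * t)))%R (s * expR (- (s * t)))%R.
Proof.
have dg : is_derive t 1%R (fun t : R => - (s * t))%R (- s)%R.
  by have := is_deriveN (is_deriveZ s (is_derive_id t (1%R : R^o))); rewrite /GRing.scale/= mulr1.
have := is_deriveN (@is_derive1_comp _ expR (fun t => - (s * t))%R t _ _ (is_derive_expR _) dg).
by rewrite /comp -mulrN opprK mulrC.
Qed.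

Lemma integral_expR_itvoc (x y : R) : (x < y)%R ->
  \int[leb]_(t in `]x, y]) (s * expR (- (s * t)))%:E =
  (expR (- (s * x)) - expR (- (s * y)))%:E.
Proof.
move=> xy.
have mE : measurable_fun `]x, y[ (fun t : R => (s * expR (- (s * t)))%:E).
  by apply/measurable_EFinP; apply: measurable_funM => //; exact: measurable_expRM.
rewrite integral_itv_bndoo// -(integral_itv_bndoo true false)//.
rewrite (@continuous_FTC2 _ _ (fun t => - expR (- (s * t)))%R)//.
- by rewrite -EFinB opprK addrC.
- apply: continuous_subspaceT => t; apply: cvgM; first exact: cvg_cst.
  exact: continuous_expRM.
- split.
  + by move=> t _; exact: ex_derive.
  + by apply/cvg_at_right_filter; apply: cvgN; exact: continuous_expRM.
  + by apply/cvg_at_left_filter; apply: cvgN; exact: continuous_expRM.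
- by move=> t _; rewrite derive1E; apply: derive_val.
Qed.

Lemma integral_expR_itvoy (x : R) :
  \int[leb]_(t in `]x, +oo[) (s * expR (- (s * t)))%:E = (expR (- (s * x)))%:E.
Proof.
rewrite integral_itv_obnd_cbnd; last first.
  by apply/measurable_EFinP; apply: measurable_funM => //; exact: measurable_expRM.
rewrite (@ge0_continuous_FTC2y _ _ (fun t => - expR (- (s * t)))%R _ 0%R)//.
- by rewrite sub0e -EFinN opprK.
- by move=> t _; rewrite mulr_ge0 ?expR_ge0 ?ltW.
- apply: continuous_subspaceT => t; apply: cvgM; first exact: cvg_cst.
  exact: continuous_expRM.
- rewrite -oppr0; apply: cvgN.
  apply: (@cvg_comp _ _ _ (fun t => s * t)%R (fun z => expR (- z))); last exact: cvgr_expR.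
  exact: gt0_cvgMry.
- by apply/cvg_at_right_filter; apply: cvgN; exact: continuous_expRM.
- by move=> t _; rewrite derive1E; apply: derive_val.
Qed.

End exp_integral.

(** Extended-real valued, so that an equation [laplace h s = g%:E] also asserts finiteness. *)
Definition laplace (R : realType) (h : R -> R) (s : R) : \bar R :=
  (\int[lebesgue_measure]_(x in `]0%R, +oo[) (expR (- (s * x)) * h x)%:E)%E.

Section laplace_exponent.
Context {R : realType}.
Local Open Scope ereal_scope.
Notation leb := (@lebesgue_measure R).
Variable (H : R -> R).
Hypotheses (Hnd : decreasing_pos H) (H0 : forall x, (0 < x)%R -> (0 <= H x)%R).

Lemma laplaceZ (s : R) : (0 <= s)%R ->
  \int[leb]_(x in `]0%R, +oo[) (s * expR (- (s * x)) * H x)%:E = s%:E * laplace H s.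
Proof.
move=> s0; rewrite -ge0_integralZl_EFin//.
- by apply: eq_integral => x _; rewrite -EFinM mulrA.
- by move=> x; rewrite /= in_itv/= andbT => x0; rewrite lee_fin mulr_ge0 ?expR_ge0 ?H0.
- apply/measurable_EFinP; apply: measurable_funM; first exact: measurable_expRM.
  exact: decreasing_pos_measurable.
Qed.

Variable m : {measure set (measurableTypeR R) -> \bar R}.
Hypothesis tail : forall t, (0 < t)%R -> m `]t, +oo[%classic = (H t)%:E.

(** Layer-cake formula for the density [s * exp (- s t)], whose integral over []0, x[] is
    [1 - exp (- s x)]. *)
Lemma integral_laplace_exponent (s : R) : (0 < s)%R ->
  \int[m]_(x in `]0%R, +oo[) (1 - expR (- (s * x)))%:E = s%:E * laplace H s.
Proof.
move=> s0; rewrite -laplaceZ ?ltW// -(integral_tail tail); last 2 first.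
- by apply: measurable_funM => //; exact: measurable_expRM.
- by move=> t; rewrite mulr_ge0 ?expR_ge0 ?ltW.
apply: eq_integral => x; rewrite inE/= in_itv/= andbT => x0.
rewrite -(integral_itv_bndoo false false) ?integral_expR_itvoc ?mulr0 ?oppr0 ?expR0//.
by apply/measurable_EFinP; apply: measurable_funM => //; exact: measurable_expRM.
Qed.

(** Layer-cake formula for the indicator of []0, 1]]. It turns the integrability condition on a Levy
    measure into integrability of its tail near the origin. *)
Lemma integral_min1 :
  \int[m]_(x in `]0%R, +oo[) (Num.min x 1)%:E = \int[leb]_(x in `]0%R, 1%R]) (H x)%:E.
Proof.
pose k : R -> R := \1_(`]0%R, 1%R]%classic : set R).
transitivity (\int[leb]_(t in `]0%R, +oo[) (k t * H t)%:E).
  rewrite -(integral_tail tail); last 2 first.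
  - exact: measurable_indic.
  - by move=> t; rewrite /k indicE.
  apply: eq_integral => x; rewrite inE/= in_itv/= andbT => x0.
  rewrite /k integral_indic//.
  have [x1|x1] := leP x 1%R.
    rewrite setIidr; first by rewrite [RHS]lebesgue_measure_itv/= lte_fin x0 sube0.
    by move=> t /=; rewrite !in_itv/= => /andP[-> /ltW/le_trans->].
  rewrite setIidl; first by rewrite [RHS]lebesgue_measure_itv/= lte_fin ltr01 sube0.
  by move=> t /=; rewrite !in_itv/= => /andP[-> /le_lt_trans->].
rewrite [LHS]integral_mkcond [RHS]integral_mkcond; apply: eq_integral => t _.
rewrite !patchE /k indicE.
have [t01|t01] := boolP (t \in (`]0%R, 1%R]%classic : set R)).
  rewrite mul1r ifT// inE; move: t01; rewrite inE /= !in_itv/= andbT.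
  by case/andP.
by rewrite mul0r; case: ifP.
Qed.

End laplace_exponent.

(** * Construction of a measure with a prescribed tail *)

(** The second hypothesis is right-continuity of the decreasing [H]. Thanks to it the generalized
    inverse [G] satisfies [t < G x] exactly when [x < H t], so its superlevel sets are the intervals
    []0, H t[], of length [H t]. *)
Lemma exists_measure_of_tail (R : realType) (H : R -> R) :
  decreasing_pos H ->
  (forall x c, 0 < x -> c < H x -> exists2 y, x < y & c < H y) ->
  (forall x, 0 < x -> 0 <= H x) ->
  H x @[x --> +oo] --> 0 ->
  exists m : {measure set (measurableTypeR R) -> \bar R},
    forall t, 0 < t -> m `]t, +oo[%classic = (H t)%:E.
Proof.
move=> Hnd Hrc H0 Hoo.
(* Decay of [H] at infinity bounds [S t]; when [S t] is empty, the convention that its [sup] is 0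
   gives the right value of [G]. *)
pose S t := [set y | 0 < y /\ t < H y]; pose G t := sup (S t).
have Sub t : 0 < t -> has_ubound (S t).
  move=> t0; have [M [_ HM]] := cvgr_lt _ Hoo _ t0.
  exists M => y [y0 ty]; rewrite leNgt; apply/negP => My.
  by have := lt_trans ty (HM _ My); rewrite ltxx.
have GP x t : 0 <= x -> 0 < t -> x < G t <-> exists2 y, x < y & t < H y.
  move=> x0 t0; split=> [xG|[y xy ty]].
    have [Se|/set0P Sn] := eqVneq (S t) set0; last first.
      by have [y [_ ty] xy] := sup_gt Sn xG; exists y.
    by move: xG; rewrite /G Se sup0 ltNge x0.
  by rewrite (lt_le_trans xy)// ub_le_sup//; [exact: Sub|split; [exact: le_lt_trans xy|]].
have G0 t : 0 < t -> 0 <= G t.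
  move=> t0; have [S0|/set0P[y Sy]] := eqVneq (S t) set0; first by rewrite /G S0 sup0.
  by rewrite (@le_trans _ _ y)//; [case: Sy => /ltW|apply: ub_le_sup => //; exact: Sub].
have Gnd : decreasing_pos G.
  move=> t t' t0 tt'; rewrite leNgt; apply/negP.
  have t'0 := lt_le_trans t0 tt'.
  move=> /(GP _ _ (G0 _ t0) t'0)[y Gy ty].
  have : G t < G t by apply/(GP _ _ (G0 _ t0) t0); exists y => //; exact: le_lt_trans ty.
  by rewrite ltxx.
pose D : set (measurableTypeR R) := `]0, +oo[%classic.
have mD : measurable D by exact: measurable_itv.
have mG : @measurable_fun _ _ (measurableTypeR R) (measurableTypeR R) setT (G \_ D).
  by apply/(measurable_restrictT _ _).1 => //; exact: decreasing_pos_measurable.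
exists (measure_function_pushforward__canonical__measure_function_Measure
  (mrestr lebesgue_measure mD) mG).
move=> t t0; rewrite /= /pushforward /mrestr.
have -> : (G \_ D @^-1` `]t, +oo[ `&` D) = `]0%R, H t[%classic.
  apply/seteqP; split => x; rewrite /D /= !in_itv/= !andbT.
    move=> [+ x0]; rewrite patchE ifT; last by rewrite inE /= in_itv/= x0.
    move=> /(GP _ _ (ltW t0) x0)[y ty xy].
    by rewrite x0 (lt_le_trans xy)// Hnd// ltW.
  move=> /andP[x0 xH]; split => //; rewrite patchE ifT; last first.
    by rewrite inE /= in_itv/= x0.
  by apply/(GP _ _ (ltW t0) x0); exact: Hrc.
rewrite [LHS]lebesgue_measure_itv/= lte_fin sube0.
by case: ltP => // /(conj (H0 _ t0)) /andP; rewrite -eq_le => /eqP <-.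
Qed.

(** * Helly's selection theorem for decreasing functions *)

(* An ultrafilter refining the Frechet filter makes all the [u k] converge at once; since only
   finitely many of them are tested at each stage, an actual subsequence can be extracted. *)
Lemma diagonal_extraction (R : realType) (u : nat -> nat -> R) :
  (forall k, exists M, forall m, `|u k m| <= M) ->
  exists phi : nat -> nat, (forall n, (n <= phi n)%N) /\
    forall k, cvgn (u k \o phi).
Proof.
move=> ub.
have [G [GU Goo]] := ultraFilterLemma (F := \oo) _.
have GP : ProperFilter G := ultra_proper.
have ucvg k : exists l : R, u k @ G --> l.
  have [M uM] := ub k.
  have : (u k @ G) `[- M, M]%classic.
    by apply: (@filterE _ G) => m; rewrite /= in_itv/= -ler_norml uM.
  move=> /(@segment_compact R (- M) M _ _)[l [_ lcl]].
  (* An ultrafilter contains either the preimage of [B] or its complement; the latter is impossible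
     because [l] is a cluster point. *)
  exists l => B lB; have [//|GC] := in_ultra_setVsetC (u k @^-1` B) GU.
  have [x [/= xnB xB]] := lcl (~` B) B GC lB; case: (xnB xB).
have [l ul] := choice ucvg.
have near_l n : \forall m \near G, forall k, (k <= n)%N -> `|l k - u k m| < n.+1%:R^-1.
  suff H j : \forall m \near G, forall k, (k < j)%N -> `|l k - u k m| < n.+1%:R^-1 by exact: (H n.+1).
  elim: j => [|j ih]; first by apply: nearW.
  have jl : \forall m \near G, `|l j - u j m| < n.+1%:R^-1.
    by move/cvgrPdist_lt : (ul j); apply; rewrite invr_gt0.
  apply: filterS2 ih jl => m ihm jm k.
  by rewrite ltnS leq_eqVlt => /predU1P[->//|]; exact: ihm.
have /choice[phi phiP] n : exists m, (n <= m)%N /\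
    forall k, (k <= n)%N -> `|l k - u k m| < n.+1%:R^-1.
  apply: (@filter_ex _ G); apply: filterI; last exact: near_l.
  by apply: Goo; exact: nbhs_infty_ge.
exists phi; split=> [n|k]; first by have [] := phiP n.
apply/cvg_ex; exists (l k); apply/cvgrPdist_lt => e e0.
near=> n; have [_ /(_ k)] := phiP n; rewrite /=.
have kn : (k <= n)%N by near: n; exact: nbhs_infty_ge.
move=> /(_ kn)/lt_trans; apply.
by near: n; exact: near_infty_natSinv_lt (PosNum e0).
Unshelve. all: by end_near. Qed.

Section integral_itvoc_bounds.
Context {R : realType}.
Local Open Scope ereal_scope.
Variables (x y M : R) (f : R -> R).
Hypotheses (xy : (x < y)%R) (mf : measurable_fun (`]x, y] : set R) f).

Let integral_cst_itvoc :
  \int[lebesgue_measure]_(t in (`]x, y] : set R)) M%:E = ((y - x) * M)%:E.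
Proof.
rewrite integral_cst//.
by rewrite [X in _ * X]lebesgue_measure_itv/= lte_fin xy -EFinB -EFinM mulrC.
Qed.

Lemma integral_itvoc_le : (forall t, x < t <= y -> 0 <= f t <= M)%R ->
  \int[lebesgue_measure]_(t in `]x, y]) (f t)%:E <= ((y - x) * M)%:E.
Proof.
move=> fM; rewrite -integral_cst_itvoc; apply: ge0_le_integral => //.
- by move=> t; rewrite /= in_itv/= lee_fin => /fM/andP[].
- exact/measurable_EFinP.
- by move=> t; rewrite /= in_itv/= lee_fin => /fM/andP[].
Qed.

Lemma integral_itvoc_ge : (0 <= M)%R -> (forall t, x < t <= y -> M <= f t)%R ->
  ((y - x) * M)%:E <= \int[lebesgue_measure]_(t in `]x, y]) (f t)%:E.
Proof.
move=> M0 fM; rewrite -integral_cst_itvoc; apply: ge0_le_integral => //.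
exact/measurable_EFinP.
Qed.

End integral_itvoc_bounds.

(** The integrand decreases, so its integral over []0, x]] is at least [x] times its value at
    [x]. *)
Lemma laplace_pointwise_bound (R : realType) (H : R -> R) (s g x : R) :
  decreasing_pos H -> (forall x, 0 < x -> 0 <= H x) -> 0 < s -> 0 < x ->
  laplace H s = g%:E -> x * (expR (- (s * x)) * H x) <= g.
Proof.
move=> Hnd H0 s0 x0 gE; rewrite -lee_fin -gE.
have mf : measurable_fun (`]0%R, +oo[ : set R) (fun t => (expR (- (s * t)) * H t)%:E).
  apply/measurable_EFinP; apply: measurable_funM; first exact: measurable_expRM.
  exact: decreasing_pos_measurable.
have sub : `]0%R, x] `<=` (`]0%R, +oo[ : set R) by exact: subset_itvl.
apply: (@le_trans _ _ (\int[lebesgue_measure]_(t in `]0%R, x]) (expR (- (s * t)) * H t)%:E)%E); last first.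
  apply: ge0_subset_integral => //.
  by move=> t; rewrite /= in_itv/= andbT => t0; rewrite lee_fin mulr_ge0 ?expR_ge0 ?H0.
rewrite -{1}[x]subr0; apply: integral_itvoc_ge => //.
- by apply/measurable_EFinP; apply: (measurable_funS _ sub mf).
- by rewrite mulr_ge0 ?expR_ge0 ?H0.
- move=> t /andP[t0 tx]; rewrite ler_pM ?expR_ge0 ?H0//.
    by rewrite ler_expR lerN2 ler_pM2l.
  exact: Hnd.
Qed.
(** A subsequence converges at all positive rationals. Defining [H x] from the limits at rationals
    strictly to the right of [x] makes it right-continuous; convergence at [x] then holds wherever
    [H] does not jump. *)
Lemma helly_selection (R : realType) (Hn : nat -> R -> R) :
  (forall n, decreasing_pos (Hn n)) -> (forall n x, 0 < x -> 0 <= Hn n x) ->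
  (forall x, 0 < x -> exists M, forall n, Hn n x <= M) ->
  exists (phi : nat -> nat) (H : R -> R) (J : set R),
    [/\ forall n, (n <= phi n)%N,
        [/\ decreasing_pos H, forall x, 0 < x -> 0 <= H x &
            forall x c, 0 < x -> c < H x -> exists2 y, x < y & c < H y],
        countable J &
        forall x, 0 < x -> ~ J x -> Hn (phi n) x @[n --> \oo] --> H x].
Proof.
move=> Hnd H0 Hb.
pose rk k : rat := odflt 0 (unpickle k).
(* The value 0 is a filler at nonpositive rationals, where nothing is known of [Hn]. *)
pose u k m := if 0 < ratr (rk k) :> R then Hn m (ratr (rk k)) else 0.
have [k|phi [phin phic]] := @diagonal_extraction R u.
  rewrite /u; case q0: (0 < ratr (rk k) :> R); last by exists 0 => m; rewrite normr0.
  by have [M HM] := Hb _ q0; exists M => m; rewrite ger0_norm// H0.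
pose L (q : rat) : R := limn (fun n => Hn (phi n) (ratr q)).
have cvL q : 0 < ratr q :> R -> Hn (phi n) (ratr q) @[n --> \oo] --> L q.
  move=> q0; have := phic (pickle q).
  by rewrite /u /rk pickleK/= q0.
have L0 q : 0 < ratr q :> R -> 0 <= L q.
  move=> q0; apply: limr_ge; first exact: cvL.
  by apply: nearW => n; exact: H0.
have Lnd q q' : 0 < ratr q :> R -> ratr q <= ratr q' :> R -> L q' <= L q.
  move=> q0 qq'; apply: ler_lim; [exact/cvL/(lt_le_trans q0)|exact: cvL|].
  by apply: nearW => n; exact: Hnd.
have ratP (x y : R) : x < y -> exists q, x < ratr q < y.
  by move=> /rat_in_itvoo[q]; rewrite in_itv/=; exists q.
have ltD (x e : R) : 0 < e -> x < x + e by move=> ?; rewrite ltrDl.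
pose S x := [set L q | q in [set q | x < ratr q :> R]].
pose H x := sup (S x).
have Sub x : 0 < x -> has_ubound (S x).
  move=> /ratP[p /andP[p0 px]]; exists (L p) => _ [q /= xq <-].
  by apply: Lnd => //; exact/ltW/(lt_trans px).
have S_ne x : S x !=set0.
  have [q /andP[xq _]] := ratP x (x + 1) (ltD x 1 ltr01).
  by exists (L q), q.
have LH x q : 0 < x -> x < ratr q -> L q <= H x.
  by move=> x0 xq; apply: ub_le_sup; [exact: Sub|exists q].
have HL x q : 0 < ratr q :> R -> ratr q <= x -> H x <= L q.
  move=> q0 qx; apply: ge_sup => // _ [p /= xp <-].
  by apply: Lnd => //; exact/ltW/(le_lt_trans qx).
have Hdec : decreasing_pos H.
  move=> x y x0 xy; apply: ge_sup => // _ [q /= yq <-].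
  by apply: LH => //; exact: le_lt_trans yq.
(* The jump points of [H], each with a rational inside the jump. Jumps of a monotone function are
   disjoint, so this rational determines the point and [J] is countable. *)
pose J := [set x | 0 < x /\ exists q : rat, H x < ratr q /\
  forall y, 0 < y -> y < x -> ratr q < H y].
exists phi, H, J; split => //.
- split => // [x x0|x c x0 cH].
    have [_ [q /= xq _]] := S_ne x.
    by rewrite (le_trans _ (LH x q x0 xq))// L0// (lt_trans x0).
  have [_ [q /= xq <-] cL] := sup_gt (S_ne x) cH.
  have [p /andP[xp pq]] := ratP _ _ xq.
  by exists (ratr p) => //; rewrite (lt_le_trans cL)// LH// (lt_trans x0).
- have /choice[f fP] (x : R) : exists q : rat, J x -> H x < ratr q /\
      forall y, 0 < y -> y < x -> ratr q < H y.
    have [[x0 [q qP]]|nJ] := pselect (J x); first by exists q.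
    by exists 0.
  have finj x y : J x -> J y -> x < y -> f x <> f y.
    move=> Jx Jy xy fxy; have [fx _] := fP x Jx; have [_ fy] := fP y Jy.
    by have := lt_trans fx; rewrite fxy => /(_ _ (fy x (proj1 Jx) xy)); rewrite ltxx.
  apply/countable_injP; exists (pickle \o f) => x y; rewrite !inE => Jx Jy.
  move=> /(pcan_inj pickleK) fxy.
  by have [xy|xy|//] := ltgtP x y; [have := finj _ _ Jx Jy xy|have /nesym := finj _ _ Jy Jx xy].
- move=> x x0 nJx; apply/cvgrPdist_lt => e e0.
  have [r /andP[Hr re]] := ratP (H x) (H x + e) (ltD _ _ e0).
  (* Absence of a jump gives a rational [p < x] with [L p] below [H x + e]; a rational [q > x] with
     [L q] above [H x - e] comes from the definition of [H]. Monotonicity squeezes the value at [x]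
     between those at [q] and [p]. *)
  have [y [y0 yx Hy]] : exists y, [/\ 0 < y, y < x & H y <= ratr r].
    apply: contrapT => nex; apply: nJx; split => //; exists r; split => // y y0 yx.
    by rewrite ltNge; apply/negP => Hy; apply: nex; exists y.
  have [p /andP[yp px]] := ratP _ _ yx.
  have p0 := lt_trans y0 yp.
  have [|_ [q /= xq <-] qe] := @sup_gt _ _ (H x - e) (S_ne x).
    by rewrite ltrBlDr ltD.
  have q0 := lt_trans x0 xq.
  have Hp : L p < H x + e by rewrite (le_lt_trans (LH y p y0 yp))// (le_lt_trans Hy).
  near=> n.
  rewrite ltr_distlC; apply/andP; split.
    apply: lt_le_trans (Hnd _ _ _ x0 (ltW xq)).
    by near: n; exact: (cvgr_gt _ (cvL q q0)).
  apply: le_lt_trans (Hnd _ _ _ p0 (ltW px)) _.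
  by near: n; exact: (cvgr_lt _ (cvL p p0)).
Unshelve. all: by end_near. Qed.

(** * Limits of Laplace transforms of decreasing functions *)

Lemma laplace_integrable (R : realType) (H : R -> R) (s g : R) :
  decreasing_pos H -> (forall x, 0 < x -> 0 <= H x) -> laplace H s = g%:E ->
  lebesgue_measure.-integrable (`]0, +oo[%classic : set R)
    (EFin \o (fun x => expR (- (s * x)) * H x)).
Proof.
move=> Hnd H0 gE; apply/integrableP; split.
  apply/measurable_EFinP; apply: measurable_funM; first exact: measurable_expRM.
  exact: decreasing_pos_measurable.
rewrite (_ : integral _ _ _ = g%:E) ?ltry// -gE; apply: eq_integral => x.
rewrite inE/= in_itv/= andbT => x0.
by rewrite /= ger0_norm// mulr_ge0 ?expR_ge0 ?H0.
Qed.

(** The upper bound is [1 - v <= exp (- v)] at [v = (s' - s) * x]. Its factor [x] is what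
    [laplace_pointwise_bound] needs to control a function unbounded near the origin. *)
Lemma expR_diff_bounds (R : realType) (s s' x : R) : 0 <= x -> s <= s' ->
  0 <= expR (- (s * x)) - expR (- (s' * x)) <= (s' - s) * x * expR (- (s * x)).
Proof.
move=> x0 ss'; rewrite subr_ge0 ler_expR lerN2 ler_wpM2r//=.
have -> : - (s' * x) = - (s * x) + - ((s' - s) * x) by ring.
rewrite expRD; have := expR_ge1Dx (- ((s' - s) * x)).
by move=> /(ler_wpM2l (expR_ge0 (- (s * x)))); lra.
Qed.

(* A decreasing limit may lose mass at the origin; this mass is the constant [a]. Differences of two
   values of the transform do not see the origin, so that dominated convergence applies to them. *)
Lemma laplace_limit (R : realType) (Hn : nat -> R -> R) (gn : nat -> R -> R) (g : R -> R) :
  (forall n, decreasing_pos (Hn n)) -> (forall n x, 0 < x -> 0 <= Hn n x) ->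
  (forall n s, 0 < s -> laplace (Hn n) s = (gn n s)%:E) ->
  (forall s, 0 < s -> gn n s @[n --> \oo] --> g s) ->
  exists (H : R -> R) (a : R),
    [/\ decreasing_pos H, forall x, 0 < x -> 0 <= H x,
        forall x c, 0 < x -> c < H x -> exists2 y, x < y & c < H y,
        0 <= a & forall s, 0 < s -> laplace H s = (g s - a)%:E].
Proof.
move=> Hnd H0 Lg gg.
have gbnd s : 0 < s -> exists M, forall n, gn n s <= M.
  move=> s0; have [M [_ HM]] := cvg_seq_bounded (cvgP _ (gg s s0)).
  exists (M + 1) => n; rewrite (le_trans (ler_norm _))//.
  by apply: HM => //; rewrite ltrDl.
have [x x0|phi [H [J [phin [HD HN Hrc] cJ HJ]]]] := helly_selection Hnd H0.
  have [M HM] := gbnd 1 ltr01; exists (M / (x * expR (- (1 * x)))) => n.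
  rewrite ler_pdivlMr ?mulr_gt0 ?expR_gt0// (le_trans _ (HM n))//.
  rewrite mulrC -mulrA.
  exact: laplace_pointwise_bound (Hnd n) (H0 n) ltr01 x0 (Lg n 1 ltr01).
have phi_oo : phi @ \oo --> \oo.
  move=> A [N _ NA]; exists N => // n /= Nn; apply: NA; exact: leq_trans (phin n).
have gphi s : 0 < s -> gn (phi n) s @[n --> \oo] --> g s.
  by move=> s0; exact: (cvg_comp _ _ phi_oo (gg s s0)).
have gn_ge0 n s : 0 < s -> 0 <= gn n s.
  move=> s0; rewrite -lee_fin -Lg//; apply: integral_ge0 => x.
  by rewrite /= in_itv/= andbT => x0; rewrite lee_fin mulr_ge0 ?expR_ge0 ?H0.
have g_ge0 s : 0 < s -> 0 <= g s.
  move=> s0; rewrite -(cvg_lim _ (gg s s0))//; apply: limr_ge; first exact: cvgP (gg s s0).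
  by apply: nearW => n; exact: gn_ge0.
have diffL s s' : 0 < s -> s <= s' ->
    (\int[lebesgue_measure]_(x in `]0%R, +oo[)
      ((expR (- (s * x)) - expR (- (s' * x))) * H x)%:E = (g s - g s')%:E)%E.
  move=> s0 ss'.
  (* Half of the exponential decay, [exp (- s x / 2)], is spent on the pointwise bound at [s / 2],
     uniform in [n]; the other half makes the dominating function integrable. *)
  have s20 : 0 < s / 2 by rewrite divr_gt0.
  have s'0 := lt_le_trans s0 ss'.
  have [M HM] := gbnd _ s20.
  pose C := (s' - s) * M / (s / 2).
  pose f_ n x := ((expR (- (s * x)) - expR (- (s' * x))) * Hn (phi n) x)%:E.
  pose dom x := (C * (s / 2 * expR (- (s / 2 * x))))%:E.
  have mexp (h : R -> R) : decreasing_pos h -> measurable_fun (`]0%R, +oo[ : set R)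
      (fun x => ((expR (- (s * x)) - expR (- (s' * x))) * h x)%:E).
    move=> hnd; apply/measurable_EFinP; apply: measurable_funM.
      by apply: measurable_funB; exact: measurable_expRM.
    exact: decreasing_pos_measurable.
  have [] := @dominated_convergence _ _ _ lebesgue_measure (`]0%R, +oo[ : set R)
    (measurable_itv _) f_ (fun x => ((expR (- (s * x)) - expR (- (s' * x))) * H x)%:E) dom.
  - by move=> n; exact: mexp.
  - exact: mexp.
  - exists J; split.
    + by apply: countable_measurable => //; exact: measurable_set1.
    + exact: countable_lebesgue_measure0.
    + move=> x /= nf; apply: contrapT => nJ; apply: nf.
      rewrite in_itv/= andbT => x0; apply: cvg_EFin; first exact: nearW.
      by apply: cvgM; [exact: cvg_cst|exact: HJ].
  - rewrite (_ : dom = fun x => (C%:E * (s / 2 * expR (- (s / 2 * x)))%:E)%E); last first.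
      by apply/funext => x; rewrite -EFinM.
    apply: integrableZl => //; apply/integrableP; split.
      by apply/measurable_EFinP; apply: measurable_funM => //; exact: measurable_expRM.
    rewrite (_ : integral _ _ _ = 1%E) ?ltry//.
    transitivity (\int[lebesgue_measure]_(x in `]0%R, +oo[)
        (s / 2 * expR (- (s / 2 * x)))%:E)%E.
      apply: eq_integral => x _.
      by rewrite gee0_abs// lee_fin mulr_ge0 ?expR_ge0 ?(ltW s20).
    by rewrite integral_expR_itvoy// mulr0 oppr0 expR0.
  - apply: aeW => x n /=; rewrite in_itv/= andbT => x0.
    have /andP[d0 d1] := expR_diff_bounds (ltW x0) ss'.
    rewrite lee_fin ger0_norm ?mulr_ge0 ?H0//.
    apply: le_trans (ler_wpM2r (H0 _ _ x0) d1) _.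
    have := laplace_pointwise_bound (Hnd (phi n)) (H0 (phi n)) s20 x0 (Lg _ _ s20).
    move=> /le_trans/(_ (HM _)).
    have -> : expR (- (s * x)) = expR (- (s / 2 * x)) * expR (- (s / 2 * x)).
      by rewrite -expRD; congr expR; field.
    set E := expR _ => bnd.
    have -> : C * (s / 2 * E) = (s' - s) * E * M by rewrite /C; field; exact: lt0r_neq0.
    have -> : (s' - s) * x * (E * E) * Hn (phi n) x = (s' - s) * E * (x * (E * Hn (phi n) x)) by ring.
    by rewrite ler_wpM2l// mulr_ge0 ?expR_ge0// subr_ge0.
  move=> _ _ cvf; apply: (cvg_unique _ cvf) => //.
  rewrite (_ : (fun n => _) = EFin \o (fun n => gn (phi n) s - gn (phi n) s')); last first.
    apply/funext => n /=; rewrite EFinB -!Lg// /laplace -integralB_EFin//.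
    - by apply: eq_integral => x _; rewrite /f_ -EFinB mulrBl.
    - exact: (laplace_integrable (Hnd _) (H0 _) (Lg _ _ s0)).
    - exact: (laplace_integrable (Hnd _) (H0 _) (Lg _ _ s'0)).
  by apply: cvg_EFin; [exact: nearW|apply: cvgB; exact: gphi].
have g_ni s s' : 0 < s -> s <= s' -> g s' <= g s.
  move=> s0 ss'; rewrite -subr_ge0 -lee_fin -diffL//.
  apply: integral_ge0 => x; rewrite /= in_itv/= andbT => x0; rewrite lee_fin.
  by have /andP[d0 _] := expR_diff_bounds (ltW x0) ss'; rewrite mulr_ge0// HN.
pose G := [set g s | s in [set s | 0 < s]].
have G_lb : lbound G 0 by move=> _ [s /= s0 <-]; exact: g_ge0.
have G_ne : G !=set0 by exists (g 1); exists 1 => //=; exact: ltr01.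
(* The escaped mass is the limit of the decreasing [g] at infinity. It is reached by taking
   [s' = s + n] in [diffL]: the right side tends to [g s - inf G], the left side to [laplace H s] by
   monotone convergence. *)
exists H, (inf G); split => //; first exact: lb_le_inf.
move=> s s0.
have gsn : (g s - g (s + n%:R)) @[n --> \oo] --> g s - inf G.
  apply: cvgB; first exact: cvg_cst.
  apply/cvgrPdist_lt => e e0.
  have [|_ [t /= t0 <-] gt] := @inf_lt _ G (inf G + e) G_ne; first by rewrite ltrDl.
  near=> n.
  have sn0 : 0 < s + n%:R by rewrite ltr_pwDl.
  rewrite distrC ger0_norm ?subr_ge0; last first.
    by apply: ge_inf; [exists 0|exists (s + n%:R)].
  rewrite ltrBlDl (le_lt_trans _ gt)// g_ni// (@le_trans _ _ n%:R)//; last by rewrite lerDr ltW.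
  by near: n; exact: nbhs_infty_ger.
pose f_ n x := ((expR (- (s * x)) - expR (- ((s + n%:R) * x))) * H x)%:E.
have f_cvg (x : R) : 0 < x -> f_ ^~ x @ \oo --> (expR (- (s * x)) * H x)%:E.
  move=> x0; apply: cvg_EFin; first exact: nearW.
  apply: cvgM; last exact: cvg_cst.
  rewrite -[X in _ --> X]subr0; apply: cvgB; first exact: cvg_cst.
  rewrite (_ : (fun n => _) = geometric (expR (- (s * x))) (expR (- x))); last first.
    apply/funext => n; rewrite /geometric/= -expRM_natl -expRD; congr expR; ring.
  by apply: cvg_geometric; rewrite ger0_norm ?expR_ge0// -expR0 ltr_expR oppr_lt0.
have mct : (\int[lebesgue_measure]_(x in `]0%R, +oo[) f_ n x)%E @[n --> \oo] -->
    (\int[lebesgue_measure]_(x in `]0%R, +oo[) limn (f_ ^~ x))%E.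
  apply: cvg_monotone_convergence => //.
  - move=> n; apply/measurable_EFinP; apply: measurable_funM.
      by apply: measurable_funB; exact: measurable_expRM.
    exact: decreasing_pos_measurable.
  - move=> n x; rewrite /= in_itv/= andbT => x0; rewrite lee_fin mulr_ge0 ?HN//.
    by rewrite subr_ge0 ler_expR lerN2 ler_wpM2r ?lerDl// ltW.
  - move=> x; rewrite /= in_itv/= andbT => x0 m n mn.
    rewrite lee_fin ler_wpM2r ?HN// lerD2l lerN2 ler_expR lerN2 ler_wpM2r ?(ltW x0)//.
    by rewrite lerD2l ler_nat.
rewrite (_ : integral _ _ _ = laplace H s) in mct; last first.
  apply: eq_integral => x; rewrite inE/= in_itv/= andbT => x0.
  exact/cvg_lim/f_cvg.
apply: (cvg_unique _ mct) => //.
rewrite (_ : (fun n => _) = EFin \o (fun n => g s - g (s + n%:R))); last first.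
  by apply/funext => n; rewrite diffL// lerDl.
by apply: cvg_EFin; [exact: nearW|exact: gsn].
Unshelve. all: by end_near. Qed.

(** * Discretization on a grid *)

Lemma log_convex_midpoint (R : realType) (h : R -> R) (x d : R) :
  log_convex_pos h -> 0 < x -> 0 < d -> h (x + d) ^+ 2 <= h x * h (x + d + d).
Proof.
move=> [hpos hlc] x0 d0.
have xd0 : 0 < x + d by rewrite addr_gt0.
have xdd0 : 0 < x + d + d by rewrite addr_gt0.
have := hlc x (x + d + d) 2^-1 x0 xdd0 ltac:(lra) ltac:(lra).
have -> : (1 - 2^-1) * x + 2^-1 * (x + d + d) = x + d by field.
move=> le_ln.
rewrite -ler_ln ?posrE ?exprn_gt0 ?mulr_gt0 ?hpos//.
rewrite lnM ?posrE ?hpos// expr2 lnM ?posrE ?hpos//; lra.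
Qed.

Section grid.
Context {R : realType}.
Local Open Scope ereal_scope.
Notation leb := (@lebesgue_measure R).
Variable d : R.
Hypothesis d0 : (0 < d)%R.

Lemma integral_grid (a : R) (f : R -> \bar R) :
  measurable_fun (`]a, +oo[ : set R) f -> (forall x, (a < x)%R -> 0 <= f x) ->
  \int[leb]_(x in `]a, +oo[) f x =
  \sum_(n <oo) \int[leb]_(x in `](a + n%:R * d)%R, (a + n.+1%:R * d)%R]) f x.
Proof.
move=> mf f0.
have gridE : `]a, +oo[%classic =
    \bigcup_n (`](a + n%:R * d)%R, (a + n.+1%:R * d)%R]%classic : set R).
  apply/seteqP; split => x; rewrite /= in_itv/= ?andbT; last first.
    move=> [n _]; rewrite /= in_itv/= => /andP[nx _].
    by rewrite (le_lt_trans _ nx)// lerDl mulr_ge0 ?(ltW d0).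
  move=> ax; have q0 : (0 < (x - a) / d)%R by rewrite divr_gt0// subr_gt0.
  have exn : exists n, ((x - a) / d <= n%:R)%R.
    by exists (Num.truncn ((x - a) / d)).+1; rewrite ltW// truncnS_gt.
  (* Cells are closed on the right: the least integer above [(x - a) / d] is the right end of the
     cell of [x], and it is a successor because this quotient is positive. *)
  case: (ex_minnP exn) => -[|n] nP nmin; first by rewrite leNgt q0 in nP.
  exists n => //; rewrite /= in_itv/=; apply/andP; split.
    rewrite -ltrBrDl -ltr_pdivlMr// ltNge; apply/negP => /nmin.
    by rewrite ltnn.
  by rewrite -lerBlDl -ler_pdivrMr.
rewrite gridE ge0_integral_bigcup//.
- by rewrite -gridE.
- by move=> x; rewrite -gridE /= in_itv/= andbT; exact: f0.
apply: ltn_trivIset => n2 n1 n12; rewrite -subset0 => x [] /=.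
rewrite !in_itv/= => /andP[_ xn1] /andP[n2x _].
have := lt_le_trans n2x xn1; rewrite ltrD2l ltr_pM2r// ltr_nat ltnS.
by rewrite leqNgt n12.
Qed.

End grid.

(* The step function carries the Kaluza tails [K] of [u n = h ((n + 1) d) + (b / d) [n = 0]]; the
   generating function of [u] at [z = exp (- s d)] is a Riemann sum [A / d] of [b + laplace h s]. *)
Lemma kaluza_step_function (R : realType) (h l : R -> R) (b d : R) :
  0 < d -> 0 <= b -> decreasing_pos h -> log_convex_pos h ->
  (forall s, 0 < s -> laplace h s = (l s)%:E) ->
  exists Hd : R -> R, [/\ decreasing_pos Hd, forall x, 0 < x -> 0 <= Hd x &
    forall s, 0 < s -> exists A, [/\ laplace Hd s = ((s * A)^-1)%:E,
      (\int[lebesgue_measure]_(x in `]d, +oo[) (expR (- (s * x)) * h x)%:E <= (A - b)%:E)%E &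
      A - b <= expR (s * d) * l s]].
Proof.
move=> d0 b0 hnd hlc hl; have hpos := proj1 hlc.
have nd0 n : 0 < n.+1%:R * d by rewrite mulr_gt0.
pose c n := h (n.+1%:R * d).
have c0 n : 0 < c n by exact: hpos.
(* Sampling starts at [d] because [h] may blow up at the origin. The drift [b] enters as mass
   [b / d] at index 0; raising [u 0] only helps log-convexity and monotonicity. *)
pose u n := c n + (if n is 0%N then b / d else 0).
have u0 n : 0 < u n.
  by case: n => [|n]; rewrite /u ?addr0// ltr_pwDl// divr_ge0// ltW.
have cu n : c n <= u n by case: n => [|n]; rewrite /u ?addr0// lerDl divr_ge0// ltW.
have ulc n : u n.+1 ^+ 2 <= u n * u n.+2.
  apply: (@le_trans _ _ (c n * c n.+2)).
    have := log_convex_midpoint hlc (nd0 n) d0.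
    by rewrite /u /c addr0 -[n.+3%:R]natr1 -[n.+2%:R]natr1 !mulrDl !mul1r.
  by rewrite /u addr0 ler_wpM2r ?(ltW (c0 _))// cu.
have und : {homo u : m n / (m <= n)%N >-> n <= m}.
  move=> m n; rewrite leq_eqVlt => /predU1P[->//|mn].
  have -> : u n = c n by case: n mn => // n _; rewrite /u addr0.
  by rewrite (le_trans _ (cu m))// hnd// ler_pM2r// ler_nat ltnW.
have [K [K0 Knd Ku]] := kaluza u0 ulc und.
pose Hd x := K (Num.truncn (x / d)) / d.
have Hd0 x : 0 < x -> 0 <= Hd x by move=> _; rewrite divr_ge0// ltW.
have Hdnd : decreasing_pos Hd.
  move=> x y x0 xy; rewrite ler_pM2r ?invr_gt0//; apply: Knd.
  by apply: le_truncn; rewrite ler_pM2r ?invr_gt0.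
exists Hd; split => // s s0.
have mexph (k : R -> R) (x : R) : decreasing_pos k -> 0 <= x ->
    measurable_fun (`]x, +oo[ : set R) (fun x => (expR (- (s * x)) * k x)%:E).
  move=> knd x0; apply/measurable_EFinP; apply: measurable_funM; first exact: measurable_expRM.
  apply: (measurable_funS _ _ (decreasing_pos_measurable knd)) => //.
  by apply: subset_itvr; rewrite bnd_simp.
have exph0 x : 0 < x -> (0 <= (expR (- (s * x)) * h x)%:E)%E.
  by move=> x0; rewrite lee_fin mulr_ge0 ?expR_ge0// ltW// hpos.
have mitv (k : R -> R) (x y : R) : decreasing_pos k -> 0 <= x ->
    measurable_fun (`]x, y] : set R) (fun x => expR (- (s * x)) * k x).
  move=> knd x0; apply/measurable_EFinP; apply: (measurable_funS _ _ (mexph k x knd x0)) => //.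
  exact: subset_itvl.
pose z := expR (- (s * d)).
have z0 : 0 < z by exact: expR_gt0.
have z1 : z < 1 by rewrite -expR0 ltr_expR oppr_lt0 mulr_gt0.
have zE n : z ^+ n = expR (- (s * (n%:R * d))).
  by rewrite /z -expRM_natl; congr expR; ring.
pose C := (\sum_(n <oo) (z ^+ n * c n)%:E)%E.
have zc0 n : (0 <= (z ^+ n * c n)%:E)%E by rewrite lee_fin mulr_ge0 ?exprn_ge0 ?ltW.
(* On the cell from [(n + 1) d] to [(n + 2) d] the integrand is at most [z ^+ n * c n]; this shift
   by one cell is why the integral starts at [d]. *)
have Clow : (\int[lebesgue_measure]_(x in `]d, +oo[) (expR (- (s * x)) * h x)%:E <= d%:E * C)%E.
  rewrite (integral_grid d0)//; last by move=> x dx; apply/exph0/(lt_trans d0).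
    rewrite -nneseriesZl; last by [].
    apply: lee_nneseries => [n _ _|n _].
      apply: integral_ge0 => x; rewrite /= in_itv/= => /andP[dx _].
      by apply/exph0/(le_lt_trans _ dx); rewrite addr_ge0 ?mulr_ge0 ?(ltW d0).
    have -> : d + n%:R * d = n.+1%:R * d by rewrite -natr1; ring.
    have -> : d + n.+1%:R * d = n.+1%:R * d + d by rewrite addrC.
    rewrite -EFinM [leRHS](_ : _ =
        ((n.+1%:R * d + d - n.+1%:R * d) * (z ^+ n * c n))%:E); last by congr EFin; ring.
    apply: integral_itvoc_le; first by rewrite ltrDl.
      by apply: mitv => //; exact: ltW.
    move=> x /andP[nx _]; have x0 := lt_trans (nd0 n) nx.
    rewrite mulr_ge0 ?expR_ge0 ?(ltW (hpos _ _))//= ler_pM ?expR_ge0 ?(ltW (hpos _ _))//.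
      rewrite zE ler_expR lerN2 ler_pM2l// (le_trans _ (ltW nx))// ler_pM2r// ler_nat//.
    by rewrite hnd// ltW.
  by apply: mexph => //; exact: ltW.
(* On the cell from [n d] to [(n + 1) d] the integrand is at least [z ^+ n.+1 * c n]; the factor
   [expR (s * d)] restores the missing power of [z]. *)
have Chigh : (d%:E * C <= (expR (s * d) * l s)%:E)%E.
  rewrite EFinM -hl// /laplace (integral_grid d0)//; last exact: mexph.
  rewrite -!nneseriesZl//.
    apply: lee_nneseries => [n _ _|n _].
      by rewrite -EFinM lee_fin mulr_ge0 ?(ltW d0)// mulr_ge0 ?(ltW (c0 _))// exprn_ge0// ltW.
    rewrite !add0r -EFinM.
    have nx : n%:R * d < n.+1%:R * d by rewrite ltr_pM2r// ltr_nat.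
    have -> : d * (z ^+ n * c n) =
        expR (s * d) * ((n.+1%:R * d - n%:R * d) * (expR (- (s * (n.+1%:R * d))) * c n)).
      rewrite zE -mulrBl -natr1 (addrC _ 1) addrK mul1r.
      rewrite (_ : - (s * (n%:R * d)) = s * d + - (s * ((1 + n%:R) * d))); last by ring.
      by rewrite expRD; ring.
    rewrite EFinM lee_wpmul2l ?lee_fin ?expR_ge0//.
    apply: integral_itvoc_ge => //.
    - by apply: mitv => //; rewrite mulr_ge0 ?(ltW d0).
    - by rewrite mulr_ge0 ?expR_ge0 ?(ltW (c0 _)).
    - move=> x /andP[nx' xn].
      have x0 : 0 < x by rewrite (le_lt_trans _ nx')// mulr_ge0 ?(ltW d0).
      by rewrite ler_pM ?expR_ge0 ?(ltW (c0 _))// ?hnd// ler_expR lerN2 ler_pM2l.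
  move=> n _; apply: integral_ge0 => x; rewrite /= in_itv/= add0r => /andP[dx _].
  by apply/exph0/(le_lt_trans _ dx); rewrite mulr_ge0 ?(ltW d0).
have C0 : (0 <= C)%E by apply: nneseries_ge0.
have Cfin : C \is a fin_num.
  rewrite ge0_fin_numE// ltNge leye_eq; apply/eqP => Coo.
  by move: Chigh; rewrite Coo gt0_muley ?lte_fin// leye_eq.
pose A := d * fine C + b.
exists A.
have UE : (\sum_(n <oo) (z ^+ n * u n)%:E = (A / d)%:E)%E.
  have zu0 n : (0 <= (z ^+ n * u n)%:E)%E by rewrite lee_fin mulr_ge0 ?exprn_ge0 ?ltW.
  have -> : A / d = fine C + b / d by rewrite /A mulrDl mulrAC divff ?mul1r// gt_eqF.
  rewrite EFinD fineK// /C [LHS]nneseries_recl// [in RHS]nneseries_recl//.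
  rewrite expr0 !mul1r EFinD -!addeA; congr (_ + _)%E; rewrite addeC; congr (_ + _)%E.
  rewrite -(@nneseries_addn _ (fun n => (z ^+ n * u n)%:E))//.
  rewrite -(@nneseries_addn _ (fun n => (z ^+ n * c n)%:E))//.
  by apply: eq_eseriesr => n _; rewrite addn1 /u addr0.
have A0 : 0 < A.
  rewrite ltr_pwDl// mulr_gt0// -lte_fin fineK//.
  apply: (@lt_le_trans _ _ (c 0%N)%:E); first by rewrite lte_fin.
  by rewrite /C nneseries_recl// expr0 mul1r leeDl// nneseries_ge0.
split; last 2 first.
- by rewrite /A addrK EFinM fineK.
- by rewrite -lee_fin /A addrK EFinM fineK.
(* Kaluza's identity says that the convolution of [u] and [K] is constantly 1, so the generating
   functions multiply to the geometric series. *)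
have prodE : ((A / d)%:E * \sum_(n <oo) (z ^+ n * K n)%:E = ((1 - z)^-1)%:E)%E.
  rewrite (nneseries_cauchy_product _ _ UE); last 2 first.
  - by move=> n; rewrite mulr_ge0 ?exprn_ge0 ?ltW.
  - by move=> n; rewrite mulr_ge0 ?exprn_ge0 ?(ltW z0).
  rewrite -nneseries_geometric ?(ltW z0)//; apply: eq_eseriesr => n _; congr EFin.
  rewrite -[RHS]mulr1 -(Ku n) mulr_sumr; apply: eq_bigr => i _.
  have <- : (z ^+ i * z ^+ (n - i) = z ^+ n) by rewrite -exprD subnKC// -ltnS.
  by ring.
(* The exponential is integrated exactly on each cell, giving [(z ^+ n - z ^+ n.+1) / s]. The
   resulting factor [1 - z] cancels the geometric series, so that the transform is exactly
   [(s * A)^-1]. *)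
transitivity (((1 - z) / (s * d))%:E * \sum_(n <oo) (z ^+ n * K n)%:E)%E.
  rewrite /laplace (integral_grid d0)//; last 2 first.
  - exact: mexph.
  - by move=> x x0; rewrite lee_fin mulr_ge0 ?expR_ge0 ?Hd0.
  rewrite -nneseriesZl; last by move=> n _; rewrite lee_fin mulr_ge0 ?exprn_ge0 ?(ltW z0).
  apply: eq_eseriesr => n _; rewrite !add0r -EFinM.
  have nx : n%:R * d < n.+1%:R * d by rewrite ltr_pM2r// ltr_nat.
  have mo (k : R -> R) : decreasing_pos k ->
      measurable_fun (`]n%:R * d, n.+1%:R * d[ : set R) (fun x => expR (- (s * x)) * k x).
    move=> knd; apply: (measurable_funS _ _ (mitv k (n%:R * d) (n.+1%:R * d) knd _)) => //.
      exact: subset_itv_oo_oc.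
    by rewrite mulr_ge0 ?(ltW d0).
  rewrite (@eq_integral_itv_bounded _ _ _ (fun x => K n / (s * d) * (s * expR (- (s * x))))).
  - under eq_integral do rewrite EFinM.
    rewrite ge0_integralZl_EFin//.
    + rewrite integral_expR_itvoc// -!zE exprS -EFinM; congr EFin.
      by field; rewrite !lt0r_neq0.
    + by move=> x _; rewrite lee_fin mulr_ge0 ?expR_ge0 ?(ltW s0).
    + by apply/measurable_EFinP; apply: measurable_funM => //; exact: measurable_expRM.
    + by rewrite divr_ge0// mulr_ge0 ?ltW.
  - exact: mo.
  - by do 2! apply: measurable_funM => //; exact: measurable_expRM.
  - move=> x; rewrite in_itv/= => /andP[nx' xn].
    have -> : Hd x = K n / d.
      rewrite /Hd; congr (K _ / _); apply: truncn_def.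
      by rewrite ler_pdivlMr// ltr_pdivrMr// (ltW nx').
    by field; rewrite !lt0r_neq0.
have Ad0 : A / d != 0 by rewrite gt_eqF// divr_gt0.
have -> : (\sum_(n <oo) (z ^+ n * K n)%:E = ((A / d)^-1 * (1 - z)^-1)%:E)%E.
  by rewrite EFinM -prodE muleA -EFinM mulVf// mul1e.
by rewrite -EFinM; congr EFin; field; rewrite !lt0r_neq0 ?subr_gt0.
Qed.

(** * Passage to the limit in the mesh, and behaviour at the origin *)

Section reciprocal_laplace.
Context {R : realType}.
Variables (h l : R -> R) (b : R).
Hypotheses (b0 : 0 <= b) (hnd : decreasing_pos h) (hlc : log_convex_pos h).
Hypothesis hl : forall s, 0 < s -> laplace h s = (l s)%:E.

Let hpos : forall x, 0 < x -> 0 < h x := proj1 hlc.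

Lemma laplace_gt0 (s : R) : 0 < s -> 0 < l s.
Proof.
move=> s0; have := laplace_pointwise_bound hnd (fun x x0 => ltW (hpos x0)) s0 ltr01 (hl s0).
by apply: lt_le_trans; rewrite mul1r mulr_gt0 ?expR_gt0 ?hpos.
Qed.

(** The mesh is [1 / (m + 1)]. Both bounds on [A m - b] tend to [l s]: the lower one because the
    domains increase to the half-line, the upper one because [expR (s / (m + 1))] tends to 1. *)
Lemma reciprocal_laplace : exists (H : R -> R) (a : R),
  [/\ decreasing_pos H, forall x, 0 < x -> 0 <= H x,
      forall x c, 0 < x -> c < H x -> exists2 y, x < y & c < H y,
      0 <= a & forall s, 0 < s -> laplace H s = ((s * (b + l s))^-1 - a)%:E].
Proof.
have dgt0 m : 0 < m.+1%:R^-1 :> R by rewrite invr_gt0.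
have /choice[Hd HdP] m := kaluza_step_function (dgt0 m) b0 hnd hlc hl.
apply: (@laplace_limit _ Hd (fun m s => fine (laplace (Hd m) s))
  (fun s => (s * (b + l s))^-1)) => [n|n|n s s0|s s0].
- by have [] := HdP n.
- by have [] := HdP n.
- by have [_ _ /(_ _ s0)[A [-> _ _]]] := HdP n.
have /choice[A AP] m : exists A, [/\ laplace (Hd m) s = ((s * A)^-1)%:E,
    (\int[lebesgue_measure]_(x in `](m.+1%:R^-1)%R, +oo[)
       (expR (- (s * x)) * h x)%:E <= (A - b)%:E)%E &
    A - b <= expR (s * m.+1%:R^-1) * l s].
  by have [_ _] := HdP m; apply.
have l0 := laplace_gt0 s0.
rewrite (_ : (fun m => _) = (fun m => (s * A m)^-1)); last first.
  by apply/funext => m; have [-> _ _] := AP m.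
apply: cvgV; first by rewrite gt_eqF// mulr_gt0// ltr_wpDl.
apply: cvgM; first exact: cvg_cst.
have -> : A = (fun m => b + (A m - b)) by apply/funext => m; ring.
apply: cvgD; first exact: cvg_cst.
suff /fine_cvg : (A m - b)%:E @[m --> \oo] --> (l s)%:E by [].
have mexph : measurable_fun (`]0, +oo[ : set R) (fun x => (expR (- (s * x)) * h x)%:E).
  apply/measurable_EFinP; apply: measurable_funM; first exact: measurable_expRM.
  exact: decreasing_pos_measurable.
apply: (@squeeze_cvge _ _ _ _
  (fun m => \int[lebesgue_measure]_(x in `](m.+1%:R^-1)%R, +oo[) (expR (- (s * x)) * h x)%:E)%E
  _ (fun m => (expR (s * m.+1%:R^-1) * l s)%:E)).
- by apply: nearW => m; have [_ -> Ab] := AP m; rewrite lee_fin.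
- rewrite -hl// /laplace.
  have -> : `]0, +oo[%classic = \bigcup_m (`](m.+1%:R^-1)%R, +oo[%classic : set R).
    apply/seteqP; split => [x|x [m _]]; rewrite /= in_itv/= andbT => x0; last first.
      by rewrite in_itv/= andbT (lt_trans _ x0).
    exists (Num.truncn x^-1) => //.
    by rewrite /= in_itv/= andbT invf_plt ?posrE// truncnS_gt.
  apply: ge0_nondecreasing_set_cvg_integral => //.
  + move=> m n mn; rewrite subsetEset; apply: subset_itvr.
    by rewrite bnd_simp lef_pV2 ?posrE// ler_nat.
  + move=> m; apply: measurable_funS mexph => //.
    by apply: subset_itvr; rewrite bnd_simp ltW.
  + move=> m x; rewrite /= in_itv/= andbT => mx.
    by rewrite lee_fin mulr_ge0 ?expR_ge0// ltW// hpos// (lt_trans _ mx).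
- apply: cvg_EFin; first exact: nearW.
  rewrite -[X in _ --> X]mul1r; apply: cvgM; last exact: cvg_cst.
  rewrite -[X in _ --> X]expR0 -[X in _ --> expR X](mulr0 s).
  apply: (@continuous_cvg _ _ _ _ _ _ expR); first exact: continuous_expR.
  by apply: cvgM; [exact: cvg_cst|exact: cvg_harmonic].
Qed.

(** Monotone convergence along [s = 1 / (n + 1)] recovers the infinite integral of [h], and [l]
    decreases in [s]. *)
Lemma laplace_unbounded :
  (\int[lebesgue_measure]_(x in `]0%R, +oo[) (h x)%:E = +oo)%E ->
  forall M, exists2 s0, 0 < s0 & forall s, 0 < s -> s <= s0 -> M < l s.
Proof.
move=> hoo M.
pose f_ n x := (expR (- (n.+1%:R^-1 * x)) * h x)%:E.
have f_cvg (x : R) : 0 < x -> f_ ^~ x @ \oo --> (h x)%:E.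
  move=> x0; apply: cvg_EFin; first exact: nearW.
  rewrite -[X in _ --> X]mul1r; apply: cvgM; last exact: cvg_cst.
  rewrite -[X in _ --> X]expR0 -[X in _ --> expR X]oppr0 -[X in _ --> expR (- X)](mul0r x).
  apply: (@continuous_cvg _ _ _ _ _ _ expR); first exact: continuous_expR.
  by apply: cvgN; apply: cvgM; [exact: cvg_harmonic|exact: cvg_cst].
have mct : (\int[lebesgue_measure]_(x in `]0%R, +oo[) f_ n x)%E @[n --> \oo] -->
    (\int[lebesgue_measure]_(x in `]0%R, +oo[) limn (f_ ^~ x))%E.
  apply: cvg_monotone_convergence => //.
  - move=> n; apply/measurable_EFinP; apply: measurable_funM; first exact: measurable_expRM.
    exact: decreasing_pos_measurable.
  - move=> n x; rewrite /= in_itv/= andbT => x0.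
    by rewrite lee_fin mulr_ge0 ?expR_ge0// ltW// hpos.
  - move=> x; rewrite /= in_itv/= andbT => x0 m n mn.
    rewrite lee_fin ler_wpM2r ?(ltW (hpos x0))// ler_expR lerN2 ler_wpM2r ?(ltW x0)//.
    by rewrite lef_pV2 ?posrE// ler_nat.
rewrite (_ : integral _ _ _ = +oo)%E in mct; last first.
  rewrite -hoo; apply: eq_integral => x; rewrite inE/= in_itv/= andbT => x0.
  exact/cvg_lim/f_cvg.
move/cvgeyPgt : mct => /(_ M)[n _ /(_ n (leqnn n)) /= Mn].
have n0 : 0 < n.+1%:R^-1 :> R by rewrite invr_gt0.
exists n.+1%:R^-1 => // s s0 sn.
rewrite -lte_fin (lt_le_trans Mn)// -[leRHS]hl//; apply: ge0_le_integral => //.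
- move=> x; rewrite /= in_itv/= andbT => x0.
  by rewrite lee_fin mulr_ge0 ?expR_ge0// ltW// hpos.
- apply/measurable_EFinP; apply: measurable_funM; first exact: measurable_expRM.
  exact: decreasing_pos_measurable.
- apply/measurable_EFinP; apply: measurable_funM; first exact: measurable_expRM.
  exact: decreasing_pos_measurable.
- move=> x; rewrite /= in_itv/= andbT => x0.
  by rewrite lee_fin ler_wpM2r ?(ltW (hpos x0))// ler_expR lerN2 ler_wpM2r// ltW.
Qed.

End reciprocal_laplace.

(** * Finiteness, tails and the proof that the conjugate is Bernstein *)

(** The integral is split at 1: the exponential is at most 1 before, and [h] is at most [h 1]
    after. *)
Lemma laplace_lty (R : realType) (h : R -> R) (s : R) :
  decreasing_pos h -> (forall x, 0 < x -> 0 <= h x) ->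
  (\int[lebesgue_measure]_(x in `]0%R, 1%R]) (h x)%:E < +oo)%E ->
  0 < s -> (laplace h s < +oo)%E.
Proof.
move=> hnd h0 h1 s0; rewrite /laplace.
have mh := decreasing_pos_measurable hnd.
have mexph : measurable_fun (`]0, +oo[ : set R) (fun x => (expR (- (s * x)) * h x)%:E).
  by apply/measurable_EFinP; apply: measurable_funM => //; exact: measurable_expRM.
have D01 : (`]0, 1] : set R) `<=` `]0, +oo[ by exact: subset_itvl.
have D1y : (`]1, +oo[ : set R) `<=` `]0, +oo[.
  by apply: subset_itvr; rewrite bnd_simp.
have exph0 x : 0 < x -> (0 <= (expR (- (s * x)) * h x)%:E)%E.
  by move=> x0; rewrite lee_fin mulr_ge0 ?expR_ge0// h0.
have DE : `]0, +oo[%classic = `]0, 1]%classic `|` `]1, +oo[%classic :> set R.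
  apply/seteqP; split=> [x|x [/D01|/D1y]]//=; rewrite !in_itv/= !andbT => x0.
  by have [x1|x1] := leP x 1; [left; rewrite x0|right].
rewrite DE ge0_integral_setU//; last 3 first.
- by rewrite -DE.
- by move=> x; rewrite -DE /= in_itv/= andbT; exact: exph0.
- rewrite disj_set2E; apply/eqP; rewrite -subset0 => x [] /=.
  by rewrite !in_itv/= andbT => /andP[_ x1]; rewrite ltNge x1.
apply: lte_add_pinfty.
  apply: le_lt_trans h1; apply: ge0_le_integral => //.
  - by move=> x; rewrite /= in_itv/= => /andP[x0 _]; exact: exph0.
  - exact: measurable_funS mexph.
  - by apply/measurable_EFinP; exact: measurable_funS mh.
  - move=> x; rewrite /= in_itv/= => /andP[x0 _]; rewrite lee_fin ler_piMl ?h0//.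
    by rewrite -expR0 ler_expR oppr_le0 mulr_ge0 ?ltW.
apply: (@le_lt_trans _ _ (\int[lebesgue_measure]_(x in `]1%R, +oo[)
    ((h 1 / s)%:E * (s * expR (- (s * x)))%:E))%E).
  apply: ge0_le_integral => //.
  - by move=> x; rewrite /= in_itv/= andbT => /(lt_trans ltr01); exact: exph0.
  - exact: measurable_funS mexph.
  - apply: emeasurable_funM => //; apply/measurable_EFinP.
    by apply: measurable_funM => //; exact: measurable_expRM.
  - move=> x; rewrite /= in_itv/= andbT => x1; rewrite -EFinM lee_fin.
    have -> : h 1 / s * (s * expR (- (s * x))) = expR (- (s * x)) * h 1.
      by field; exact: lt0r_neq0.
    by rewrite ler_wpM2l ?expR_ge0// hnd// ltW.
rewrite ge0_integralZl_EFin//.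
- by rewrite integral_expR_itvoy// -EFinM ltry.
- by move=> x _; rewrite lee_fin mulr_ge0 ?expR_ge0 ?ltW.
- by apply/measurable_EFinP; apply: measurable_funM => //; exact: measurable_expRM.
- by rewrite divr_ge0 ?h0 ?ltW.
Qed.

(** Continuity from below along the intervals []t, t + n]], together with the decay of [h]. *)
Lemma minus_dh_tail (R : realType) (h : R -> R)
    (mu : {measure set (measurableTypeR R) -> \bar R}) :
  minus_dh h mu -> h x @[x --> +oo] --> 0 ->
  forall t, 0 < t -> mu `]t, +oo[%classic = (h t)%:E.
Proof.
move=> muh hoo t t0.
have cvmu : mu (`]t, t + n%:R]%classic : set R) @[n --> \oo] --> mu `]t, +oo[%classic.
  rewrite [X in mu X](_ : _ = \bigcup_n (`]t, t + n%:R]%classic : set R)); last first.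
    apply/seteqP; split => [x|x [n _]]; rewrite /= in_itv/= ?andbT => tx; last first.
      by rewrite in_itv/= andbT; case/andP: tx.
    exists (Num.truncn (x - t)).+1 => //; rewrite /= in_itv/= tx/=.
    by rewrite -lerBlDl ltW// truncnS_gt.
  apply: nondecreasing_cvg_mu => //.
  - exact: bigcup_measurable.
  - move=> m n mn; rewrite subsetEset; apply: subset_itvl.
    by rewrite bnd_simp lerD2l ler_nat.
apply: (cvg_unique _ cvmu) => //.
rewrite (_ : (fun n => _) = EFin \o (fun n => h t - h (t + n%:R))); last first.
  by apply/funext => n; rewrite /= muh// lerDl.
apply: cvg_EFin; first exact: nearW.
rewrite -[X in _ --> X]subr0; apply: cvgB; first exact: cvg_cst.
apply: (cvg_comp _ _ _ hoo); apply/cvgryPge => M; near=> n.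
by rewrite -lerBlDl; near: n; exact: nbhs_infty_ger.
Unshelve. all: by end_near. Qed.

Lemma laplace_exponent_at0 (R : realType) (m : {measure set (measurableTypeR R) -> \bar R}) :
  (\int[m]_(x in `]0%R, +oo[) (1 - expR (- (0 * x)))%:E = 0)%E.
Proof. by apply: integral0_eq => x _; rewrite mul0r oppr0 expR0 subrr. Qed.

(** On []0, 1]] one has [1 <= exp 1 * exp (- x)]. *)
Lemma integral01_lty_of_laplace (R : realType) (H : R -> R) :
  decreasing_pos H -> (forall x, 0 < x -> 0 <= H x) -> (laplace H 1 < +oo)%E ->
  (\int[lebesgue_measure]_(x in `]0%R, 1%R]) (H x)%:E < +oo)%E.
Proof.
move=> Hnd H0 Hoo.
have mH := decreasing_pos_measurable Hnd.
have D01 : (`]0, 1] : set R) `<=` `]0, +oo[ by exact: subset_itvl.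
have mexp : measurable_fun (`]0, +oo[ : set R) (fun x => (expR (- (1 * x)) * H x)%:E).
  by apply/measurable_EFinP; apply: measurable_funM => //; exact: measurable_expRM.
apply: (@le_lt_trans _ _ ((expR 1)%:E * laplace H 1)%E); last first.
  by apply: lte_mul_pinfty => //; rewrite lee_fin expR_ge0.
apply: (@le_trans _ _ ((expR 1)%:E *
    \int[lebesgue_measure]_(x in `]0%R, 1%R]) (expR (- (1 * x)) * H x)%:E)%E); last first.
  rewrite lee_wpmul2l ?lee_fin ?expR_ge0//; apply: ge0_subset_integral => //.
  by move=> x; rewrite /= in_itv/= andbT => x0; rewrite lee_fin mulr_ge0 ?expR_ge0 ?H0.
have e0 x : 0 < x -> (0 <= (expR (- (1 * x)) * H x)%:E)%E.
  by move=> x0; rewrite lee_fin mulr_ge0 ?expR_ge0 ?H0.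
rewrite -ge0_integralZl_EFin ?expR_ge0//; last 2 first.
- by move=> x; rewrite /= in_itv/= => /andP[x0 _]; exact: e0.
- exact: measurable_funS mexp.
apply: ge0_le_integral => //.
- by move=> x; rewrite /= in_itv/= => /andP[x0 _]; rewrite lee_fin H0.
- by apply/measurable_EFinP; exact: measurable_funS mH.
- by apply: emeasurable_funM => //; exact: measurable_funS mexp.
- move=> x; rewrite /= in_itv/= => /andP[x0 x1]; rewrite -EFinM lee_fin mulrA -expRD.
  by rewrite ler_peMl ?H0// -[leLHS]expR0 ler_expR; lra.
Qed.

Theorem theorem2p7 (R : realType) (Psi : R -> R) : Lambda Psi -> Sigma Psi.
Proof.
move=> [b [h [mu [b0 [hnd [hlc [h1 [hoo [hlim [muh PsiE]]]]]]]]]].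
have hpos := proj1 hlc.
have hge0 x : 0 < x -> 0 <= h x by move=> /hpos/ltW.
have tail := minus_dh_tail muh hlim.
pose l s := fine (laplace h s).
have hl s : 0 < s -> laplace h s = (l s)%:E.
  move=> s0; rewrite fineK// ge0_fin_numE ?laplace_lty//.
  by apply: integral_ge0 => x; rewrite /= in_itv/= andbT => x0; rewrite lee_fin mulr_ge0 ?expR_ge0 ?hge0.
have l0 s : 0 < s -> 0 < l s by exact: (laplace_gt0 hnd hlc hl).
have bl0 s : 0 < s -> 0 < b + l s by move=> /l0; exact: ltr_wpDl.
have Psi_pos s : 0 < s -> Psi s = s * (b + l s).
  move=> s0; rewrite PsiE ?ltW// (integral_laplace_exponent hnd hge0 tail)// hl//.
  by rewrite mulrDr [b * s]mulrC.
have PsiV s : 0 < s -> s / Psi s = (b + l s)^-1.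
  by move=> s0; rewrite Psi_pos// invfM mulrA divff ?mul1r// gt_eqF.
have Psi_bernstein : bernstein Psi.
  by exists b, mu; split => //; split => //; rewrite (integral_min1 tail).
split => //; split.
  by exists 1; rewrite Psi_pos// mul1r gt_eqF ?bl0.
(* The value 0 at the origin is the limit of [1 / (b + l s)], since [l] is unbounded there. *)
pose Phi s := if 0 < s then s / Psi s else 0.
exists Phi; split.
  split=> [s s0|]; first by rewrite /Phi s0.
  rewrite /Phi ltxx; apply/cvgrPdist_lt => e e0.
  have [s0 s0_gt0 ls0] := laplace_unbounded hnd hlc hl hoo e^-1.
  near=> s.
  have s_gt0 : 0 < s by near: s; exact: nbhs_right_gt.
  have ss0 : s <= s0 by near: s; exact: nbhs_right_le.
  rewrite sub0r normrN PsiV// ger0_norm ?invr_ge0 ?(ltW (bl0 _ _))//.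
  rewrite invf_plt ?posrE ?bl0//.
  by rewrite (lt_le_trans (ls0 s s_gt0 ss0))// lerDr.
have [H [a [Hnd H0 Hrc a0 HE]]] := reciprocal_laplace b0 hnd hlc hl.
have Hoo : H x @[x --> +oo] --> 0.
  apply/cvgrPdist_lt => e e0.
  (* The pointwise bound for [H] at frequency [1 / x] reads [exp (-1) * H x <= 1 / (b + l (1 / x))];
     the threshold carries the factor [expR 1] to absorb [exp (-1)]. *)
  have [s0 s0_gt0 ls0] := laplace_unbounded hnd hlc hl hoo (e^-1 * expR 1).
  near=> x.
  have x0 : 0 < x by near: x; exact: nbhs_pinfty_gt.
  have xs0 : x^-1 <= s0.
    by rewrite invf_ple ?posrE//; near: x; exact: nbhs_pinfty_ge.
  have xV0 : 0 < x^-1 by rewrite invr_gt0.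
  have := laplace_pointwise_bound Hnd H0 xV0 x0 (HE _ xV0).
  rewrite mulVf ?gt_eqF// => /le_trans/(_ (_ : _ <= x / (b + l x^-1))).
  rewrite invfM invrK gerBl => /(_ a0).
  rewrite ler_pM2l// => bnd.
  rewrite sub0r normrN ger0_norm ?H0//.
  have lx := ls0 _ xV0 xs0.
  have : expR (-1) * H x < expR (-1) * e.
    rewrite (le_lt_trans bnd)// invf_plt ?posrE ?bl0 ?mulr_gt0 ?expR_gt0//.
    rewrite invfM expRN invrK mulrC (lt_le_trans lx)// lerDr//.
  by rewrite ltr_pM2l ?expR_gt0.
have [lam lamE] := exists_measure_of_tail Hnd Hrc H0 Hoo.
exists a, lam; split => //; split.
  rewrite (integral_min1 lamE); apply: integral01_lty_of_laplace => //.
  by rewrite HE// ltry.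
move=> s; rewrite le_eqVlt => /predU1P[<-|s0].
  by rewrite /Phi ltxx mulr0 laplace_exponent_at0 addr0.
(* The mass [a] subtracted in [laplace H s] is given back by the drift: [a * s + s * ((s * (b + l
   s))^-1 - a) = (b + l s)^-1]. *)
rewrite (integral_laplace_exponent Hnd H0 lamE)// HE//= /Phi s0 PsiV//.
by field; rewrite !gt_eqF ?bl0.
Unshelve. all: by end_near. Qed.
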